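(* Let $0\le a<b$, let $f:[a,b]\to\mathbb{R}$ be continuous, let $P=[P^{\mathrm{left}},P^{\mathrm{right}}]\subset(0,\infty)$ be a compact interval, let $(t_k)_{k\ge1}$ be a sequence in $(0,1]$, and let $n,m\ge 1$ be integers. Let $\varphi_1,\dots,\varphi_n$ be the successive approximations of $f$ produced by the implementation of the weak Chebyshev greedy algorithm (WCGA) in the uniform norm described in the context. Then $$\|f-\varphi_k\|_\infty\le\|f-\varphi_{k-1}\|_\infty\quad\text{for } k=2,\dots,n .$$
   Context: Norm: $\|u\|_\infty=\sup_{z\in[a,b]}|u(z)|$ for $u\in C([a,b])$. For $p>0$ let $g(p)\in C([a,b])$ denote the function $z\mapsto \frac{1}{z+p}$ (whose pole is the negative number $-p$). Algorithm (WCGA in the uniform norm). Input: $[a,b]$, $P$, $f$, $(t_k)$, $n$, $m$. Initialize $\varphi_0=0$, $r_0=f$, and let $z_0^*\in[a,b]$ be a point where $|r_0|$ attains its maximum. For $k=1,\dots,n$: 1. If $r_{k-1}(z_{k-1}^* )<0$, set $\tilde P_k^{\mathrm{left}}=\frac{z_{k-1}^*+P^{\mathrm{right}}}{t_k}-z_{k-1}^*$ and $\tilde P_k^{\mathrm{right}}=P^{\mathrm{right}}$. Otherwise set $\tilde P_k^{\mathrm{left}}=P^{\mathrm{left}}$ and $\tilde P_k^{\mathrm{right}}=\frac{z_{k-1}^*+P^{\mathrm{left}}}{t_k}-z_{k-1}^*$. 2. Let $\tilde P_k^i=\tilde P_k^{\mathrm{left}}+\frac{i}{m}\left(\tilde P_k^{\mathrm{right}}-\tilde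 P_k^{\mathrm{left}}\right)$ for $i=0,1,\dots,m$. 3. For $i=0,1,\dots,m$ in order: let $X_k=\operatorname{span}\{g_1,\dots,g_{k-1},g(\tilde P_k^i)\}$ and let $\varphi_k\in X_k$ be a best uniform approximation of $f$ from $X_k$, i.e. $\|f-\varphi_k\|_\infty=\min_{\varphi\in X_k}\|f-\varphi\|_\infty$ (any minimizer). If $\|f-\varphi_k\|_\infty<\|f-\varphi_{k-1}\|_\infty$, set $g_k=g(\tilde P_k^i)$ and leave this inner loop. If the strict inequality fails for every $i=0,\dots,m$, set $g_k=g(\tilde P_k^m)=g(\tilde P_k^{\mathrm{right}})$ and keep the $\varphi_k$ computed for $i=m$. 4. Set $r_k=f-\varphi_k$ and let $z_k^*\in[a,b]$ be a point where $|r_k|$ attains its maximum. *)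

(* Defs.v *)
From HB Require Import structures.
From mathcomp Require Import all_boot all_order all_algebra.
From mathcomp Require Import all_classical all_reals all_analysis.
Import Order.TTheory GRing.Theory Num.Theory.
Import numFieldNormedType.Exports.

Set Implicit Arguments.
Unset Strict Implicit.
Unset Printing Implicit Defensive.

Local Open Scope classical_set_scope.
Local Open Scope ring_scope.

(* An element of C([a, b]) is represented by a function on the whole line of
   which only the values on [a, b] are ever used. *)

Definition unorm (R : realType) (a b : R) (u : R -> R) : R :=
  sup [set `|u z| | z in [set` `[a, b]]].

Definition polefun (R : realType) (p : R) : R -> R := fun z => 1 / (z + p).

(* The span is taken in C([a, b]): the linear combination is only compared
   with u on [a, b]. *)
Definition spanC (R : realType) (a b : R) (s : seq (R -> R)) : set (R -> R) :=
  [set u | exists c : 'I_(size s) -> R,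
     forall z, z \in `[a, b] -> u z = \sum_(i < size s) c i * s`_i z].

Definition best_uniform_approx (R : realType) (a b : R) (f : R -> R)
    (X : set (R -> R)) (phi : R -> R) : Prop :=
  X phi /\ forall psi, X psi -> unorm a b (f \- phi) <= unorm a b (f \- psi).

Definition abs_max_at (R : realType) (a b : R) (r : R -> R) (z : R) : Prop :=
  z \in `[a, b] /\ forall x, x \in `[a, b] -> `|r x| <= `|r z|.

(* Endpoints of the search interval of iteration k, with r = r_(k-1),
   z = z*_(k-1) and t = t_k; they need not be in increasing order. *)
Definition tPleft (R : realType) (Pl Pr t : R) (r : R -> R) (z : R) : R :=
  if r z < 0 then (z + Pr) / t - z else Pl.

Definition tPright (R : realType) (Pl Pr t : R) (r : R -> R) (z : R) : R :=
  if r z < 0 then Pr else (z + Pl) / t - z.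

Definition tPgrid (R : realType) (Pl Pr t : R) (m : nat) (r : R -> R) (z : R)
    (i : nat) : R :=
  tPleft Pl Pr t r z
  + i%:R / m%:R * (tPright Pl Pr t r z - tPleft Pl Pr t r z).

(* Iteration k + 1 of the algorithm. Here i is the index at which the inner
   loop ends: at every earlier j some best approximation psi was computed and
   did not strictly improve the error; at i either it does, or i = m. *)
Definition wcga_step (R : realType) (a b Pl Pr : R) (f : R -> R) (t : nat -> R)
    (m : nat) (g phi : nat -> R -> R) (zs : nat -> R) (k : nat) : Prop :=
  let r := f \- phi k in
  let p := tPgrid Pl Pr (t k.+1) m r (zs k) in
  let X j := spanC a b (rcons [seq g l | l <- iota 1 k] (polefun (p j))) in
  let err u := unorm a b (f \- u) in
  (exists2 i : nat, (i <= m)%N &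
     [/\ forall j, (j < i)%N ->
           exists2 psi, best_uniform_approx a b f (X j) psi
                      & ~ (err psi < err (phi k)),
         best_uniform_approx a b f (X i) (phi k.+1),
         err (phi k.+1) < err (phi k) \/ i = m
       & g k.+1 = polefun (p i)])
  /\ abs_max_at a b (f \- phi k.+1) (zs k.+1).

(* A run is a relation, not a function, because the best approximations and
   the maximum points are arbitrary choices; g 0 is never used. *)
Definition wcga_run (R : realType) (a b Pl Pr : R) (f : R -> R) (t : nat -> R)
    (n m : nat) (g phi : nat -> R -> R) (zs : nat -> R) : Prop :=
  [/\ forall x, x \in `[a, b] -> phi 0%N x = 0,
      abs_max_at a b (f \- phi 0%N) (zs 0%N)
    & forall k, (k < n)%N -> wcga_step a b Pl Pr f t m g phi zs k].

(* Main.v *)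
Require Import Defs.
From HB Require Import structures.
From mathcomp Require Import all_boot all_order all_algebra.
From mathcomp Require Import all_classical all_reals all_analysis.
Import Order.TTheory GRing.Theory Num.Theory.
Import numFieldNormedType.Exports.
Local Open Scope classical_set_scope.
Local Open Scope ring_scope.

(** Whichever way the inner loop ends, the pole it settles on is the one for
    which [phi k] was computed, so [phi k] lies in the span of [g 1, ..., g k]
    ([wcga_step_span]). The space searched at iteration [k + 1] is spanned by
    these functions and one more, hence contains [phi k] ([spanC_rcons]), and
    a best approximation from it is at least as good as [phi k]. *)

Lemma spanC_rcons (R : realType) (a b : R) (s : seq (R -> R)) (h : R -> R) :
  spanC a b s `<=` spanC a b (rcons s h).
Proof.
move=> u [c uE].
(* The coefficients are extended by 0 to all of nat, so that the size of
   the list can be rewritten in the range of the sum. *)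
pose C i := if insub i is Some j then c j else 0.
exists (fun i => C i) => z zab.
rewrite uE// size_rcons big_ord_recr/= {2}/C insubF ?ltnn// mul0r addr0.
by apply: eq_bigr => i _; rewrite /C valK nth_rcons ltn_ord.
Qed.

Lemma wcga_step_span (R : realType) (a b Pl Pr : R) (f : R -> R)
    (t : nat -> R) (m : nat) (g phi : nat -> R -> R) (zs : nat -> R) (k : nat) :
  wcga_step a b Pl Pr f t m g phi zs k ->
  spanC a b [seq g l | l <- iota 1 k.+1] (phi k.+1).
Proof.
move=> [[i _ [_ [Xphi _] _ gE]] _].
have -> : iota 1 k.+1 = rcons (iota 1 k) k.+1.
  by have := iotaD 1 k 1; rewrite addn1 add1n cats1.
by rewrite map_rcons gE.
Qed.

Theorem theorem3p3 (R : realType) (a b : R) (ha : 0 <= a) (hab : a < b)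
    (f : R -> R) (hf : {within [set` `[a, b]], continuous f})
    (Pl Pr : R) (hPl : 0 < Pl) (hP : Pl <= Pr)
    (t : nat -> R) (ht : forall k, (1 <= k)%N -> 0 < t k <= 1)
    (n m : nat) (hn : (1 <= n)%N) (hm : (1 <= m)%N)
    (g phi : nat -> R -> R) (zs : nat -> R)
    (hrun : wcga_run a b Pl Pr f t n m g phi zs) :
  forall k, (2 <= k <= n)%N ->
    unorm a b (f \- phi k) <= unorm a b (f \- phi k.-1).
Proof.
case: hrun => _ _ step [|[|k]]//= kn.
have [[i _ [_ [_ phi_best] _ _]] _] := step _ kn.
by apply: phi_best; apply/spanC_rcons/wcga_step_span/step/ltnW.
Qed.
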